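(* Let $H$ be a Hopf algebra with bijective antipode, $A$ a right $H$-comodule Poisson 3-Lie algebra, and $M$ a Poisson 3-Lie $(A,H)$-Hopf module. Let $\phi:H\to A^A$ be a right $H$-colinear algebra map. Suppose that $M^{coH}$ and $A^{coH}$ are trivial 3-Lie $A$-modules under $\diamond'$, i.e. $(x,y)\diamond' m=0$ for all $x,y\in A$, $m\in M^{coH}$ and $(x,y)\diamond' a=0$ for all $x,y\in A$, $a\in A^{coH}$. Put $B=A^{AcoH}$. Then the linear map $$\alpha:A\otimes_B M^{AcoH}\to M,\qquad a\otimes_B m\mapsto a\cdot m,$$ is an isomorphism of Poisson 3-Lie $(A,H)$-Hopf modules.
   Context: Everything is over a fixed field $k$ of characteristic 0; algebras are associative and unital and algebra maps are unital. $H$ is a Hopf algebra with antipode $S$ and $\Delta(h)=h_1\otimes h_2$; right $H$-coactions are written $\rho(m)=m_{(0)}\otimes m_{(1)}$, and $M^{coH}=\{m\in M: \rho(m)=m\otimes 1_H\}$. $H$ is a right $H$-comodule via $\Delta$. A 3-Lie algebra is a vector space $A$ with a skew-symmetric trilinear bracket $\{-,-,-\}:A^{\otimes 3}\to A$ satisfying $\{\{x,y,z\},u,v\}=\{\{x,u,v\},y,z\}+\{\{y,u,v\},z,x\}+\{\{z,u,v\},x,y\}$. A 3-Lie $A$-module is a vector space $M$ with a trilinear map $A\times A\times M\to M$, $(x,y,m)\mapsto (x,y)\diamond m$, such that $(x,y)\diamond m=-(y,x)\diamond m$; $(x,y)\diamond((u,v)\diamond m)-(u,v)\diamond((x,y)\diamond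 m)=(\{x,y,u\},v)\diamond m+(u,\{x,y,v\})\diamond m$; $(\{x,y,u\},v)\diamond m=(y,u)\diamond((x,v)\diamond m)-(x,u)\diamond((y,v)\diamond m)+(x,y)\diamond((u,v)\diamond m)$. A Poisson 3-Lie algebra is a commutative associative algebra $A$ with a 3-Lie bracket such that $\{x,y,uv\}=u\{x,y,v\}+\{x,y,u\}v$. A Poisson 3-Lie $A$-module is an $A$-module $(M,\cdot)$ which is also a 3-Lie $A$-module $(M,\diamond)$ with $(xy,z)\diamond m=x\cdot((y,z)\diamond m)+y\cdot((x,z)\diamond m)$ and $(x,y)\diamond(z\cdot m)=\{x,y,z\}\cdot m+z\cdot((x,y)\diamond m)$. A right $H$-comodule Poisson 3-Lie algebra is a Poisson 3-Lie algebra $A$ that is a right $H$-comodule algebra with $\rho(\{x,y,z\})=\{x_{(0)},y_{(0)},z_{(0)}\}\otimes x_{(1)}y_{(1)}z_{(1)}$. A Poisson 3-Lie $(A,H)$-Hopf module is a Poisson 3-Lie $A$-module $M$ that is an $(A,H)$-Hopf module (a left $A$-module and right $H$-comodule with $\rho(a\cdot m)=a_{(0)}\cdot m_{(0)}\otimes a_{(1)}m_{(1)}$) such that $\rho((x,y)\diamond m)=(x_{(0)},y_{(0)})\diamond m_{(0)}\otimes x_{(1)}y_{(1)}m_{(1)}$. Morphisms are maps that are $A$-linear, 3-Lie $A$-linear ($f((x,y)\diamond m)=(x,y)\diamond f(m)$) and $H$-colinear. $A$ itself is such a module with $(x,y)\diamond a=\{x,y,a\}$. Invariants: $A^A=\{b\in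 A:\{b,A,A\}=0\}$ (a subalgebra and $H$-subcomodule of $A$), $M^A=\{m\in M:(x,y)\diamond m=0\ \forall x,y\in A\}$, $A^{AcoH}=A^A\cap A^{coH}$, $M^{AcoH}=M^A\cap M^{coH}$. Given $\phi$, define $p_M:M\to M$, $p_M(m)=\phi(S^{-1}(m_{(1)}))\cdot m_{(0)}$, and $(x,y)\diamond' m=p_M((x,y)\diamond m)$; in particular, for $M=A$, $(x,y)\diamond' a=p_A(\{x,y,a\})$. The space $A\otimes_B M^{AcoH}$ is a Poisson 3-Lie $(A,H)$-Hopf module via $x\cdot(a\otimes_B m)=xa\otimes_B m$, $(x,y)\diamond(a\otimes_B m)=\{x,y,a\}\otimes_B m$, $\rho(a\otimes_B m)=a_{(0)}\otimes_B m\otimes a_{(1)}$. *)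

(* Defs.v *)
From HB Require Import structures.
From mathcomp Require Import all_boot all_order all_algebra generic_quotient.
From mathcomp Require Import boolp.

Set Implicit Arguments.
Unset Strict Implicit.
Unset Printing Implicit Defensive.

Import GRing.Theory.
Local Open Scope ring_scope.
Local Open Scope quotient_scope.

Reserved Notation "u \ot v" (at level 40, left associativity).
Reserved Notation "\tsum_ ( a , b <- t ) E"
  (at level 41, E at level 41, a name, b name,
   format "'[' \tsum_ ( a ,  b  <-  t ) '/  '  E ']'").

(** Balanced tensor products.  [S] acts on [U] by [l] (linearly over [k]) and
    on [V] by [r]; [tens l r] is the quotient of the formal sums
    [\sum_i u_i (x) v_i], encoded as lists of pairs, by the congruence generated
    by biadditivity and [l s u (x) v = u (x) r s v].  Opposites are not needed
    as generators, because [- (u (x) v) = (- u) (x) v].  The scalars of [k] act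
    on the left factor.  With [S := k] acting by scaling, this is the tensor
    product over [k]. *)
Section Tensor.

Variables (k : fieldType) (S : Type) (U V : lmodType k).
Variables (l : S -> {linear U -> U}) (r : S -> V -> V).

Inductive tens_eq : seq (U * V) -> seq (U * V) -> Prop :=
| tens_eq_refl s : tens_eq s s
| tens_eq_sym s t : tens_eq s t -> tens_eq t s
| tens_eq_trans s t w : tens_eq s t -> tens_eq t w -> tens_eq s w
| tens_eq_cat s t s' t' : tens_eq s s' -> tens_eq t t' ->
    tens_eq (s ++ t) (s' ++ t')
| tens_eq_catC s t : tens_eq (s ++ t) (t ++ s)
| tens_eq_0 v : tens_eq [:: (0, v)] [::]
| tens_eq_Dl u u' v : tens_eq [:: (u + u', v)] [:: (u, v); (u', v)]
| tens_eq_Dr u v v' : tens_eq [:: (u, v + v')] [:: (u, v); (u, v')]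
| tens_eq_bal s u v : tens_eq [:: (l s u, v)] [:: (u, r s v)].

Definition tens_eqb (s t : seq (U * V)) : bool := `[< tens_eq s t >].

Fact tens_eqb_refl : reflexive tens_eqb.
Proof. by move=> s; apply/asboolP; apply: tens_eq_refl. Qed.

Fact tens_eqb_sym : symmetric tens_eqb.
Proof. by move=> s t; apply: asbool_equiv_eq; split; apply: tens_eq_sym. Qed.

Fact tens_eqb_trans : transitive tens_eqb.
Proof.
by move=> t s w /asboolP st /asboolP tw; apply/asboolP; apply: tens_eq_trans tw.
Qed.

Canonical tens_equiv :=
  EquivRel tens_eqb tens_eqb_refl tens_eqb_sym tens_eqb_trans.

Definition tens := {eq_quot tens_equiv}.
HB.instance Definition _ := Choice.on tens.
HB.instance Definition _ := EqQuotient.on tens.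

Lemma tens_piP s t : (\pi_tens s = \pi_tens t) <-> tens_eq s t.
Proof.
split=> [/eqP|st]; last by apply/eqP; rewrite piE; apply/asboolP.
by rewrite piE => /asboolP.
Qed.

Lemma tens_reprP s : tens_eq (repr (\pi_tens s)) s.
Proof. by apply/tens_piP; rewrite reprK. Qed.

Definition pure (u : U) (v : V) : tens := \pi_tens [:: (u, v)].
Definition tens_zero : tens := \pi_tens [::].
Definition tens_add (x y : tens) : tens := \pi_tens (repr x ++ repr y).
Definition tens_map (f : U -> U) (s : seq (U * V)) := [seq (f p.1, p.2) | p <- s].
Definition tens_opp (x : tens) : tens := \pi_tens (tens_map -%R (repr x)).
Definition tens_scale (c : k) (x : tens) : tens :=
  \pi_tens (tens_map ( *:%R c) (repr x)).

Lemma tens_map_eq (f : {linear U -> U}) s t :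
  (forall z u, f (l z u) = l z (f u)) ->
  tens_eq s t -> tens_eq (tens_map f s) (tens_map f t).
Proof.
move=> fl; rewrite /tens_map; elim=> {s t}.
- by move=> s; apply: tens_eq_refl.
- by move=> s t _ IH; apply: tens_eq_sym.
- by move=> s t w _ IH _ IH'; apply: tens_eq_trans IH'.
- by move=> s t s' t' _ IH _ IH'; rewrite !map_cat; apply: tens_eq_cat.
- by move=> s t; rewrite !map_cat; apply: tens_eq_catC.
- by move=> v /=; rewrite linear0; apply: tens_eq_0.
- by move=> u u' v /=; rewrite linearD; apply: tens_eq_Dl.
- by move=> u v v' /=; apply: tens_eq_Dr.
- by move=> z u v /=; rewrite fl; apply: tens_eq_bal.
Qed.

Lemma tens_pi_add s t : tens_add (\pi_tens s) (\pi_tens t) = \pi_tens (s ++ t).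
Proof. by apply/tens_piP; apply: tens_eq_cat; apply: tens_reprP. Qed.

Lemma tens_pi_opp s : tens_opp (\pi_tens s) = \pi_tens (tens_map -%R s).
Proof.
apply/tens_piP; have := tens_reprP s.
by apply: tens_map_eq => z u /=; rewrite linearN.
Qed.

Lemma tens_pi_scale c s :
  tens_scale c (\pi_tens s) = \pi_tens (tens_map ( *:%R c) s).
Proof.
apply/tens_piP; have := tens_reprP s.
by apply: tens_map_eq => z u /=; rewrite linearZ.
Qed.

Fact tens_addA : associative tens_add.
Proof.
elim/quotW=> x; elim/quotW=> y; elim/quotW=> z.
by rewrite (tens_pi_add y z) (tens_pi_add x y) !tens_pi_add catA.
Qed.

Fact tens_addC : commutative tens_add.
Proof. by move=> x y; apply/tens_piP; apply: tens_eq_catC. Qed.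

Fact tens_add0 : left_id tens_zero tens_add.
Proof. by move=> x; rewrite -[x]reprK tens_pi_add. Qed.

Fact tens_addN : left_inverse tens_zero tens_opp tens_add.
Proof.
move=> x; rewrite -[x]reprK tens_pi_opp tens_pi_add; apply/tens_piP.
elim: (repr x) => [|[u v] s IH] /=; first exact: tens_eq_refl.
rewrite -[(- u, v) :: _]/([:: (- u, v)] ++ (tens_map -%R s ++ (u, v) :: s)).
apply: (@tens_eq_trans _ ([:: (- u, v)] ++ ([:: (u, v)] ++ (tens_map -%R s ++ s)))).
  apply: tens_eq_cat; first exact: tens_eq_refl.
  rewrite -[(u, v) :: s]/([:: (u, v)] ++ s) !catA.
  by apply: tens_eq_cat; [apply: tens_eq_catC | apply: tens_eq_refl].
apply: (@tens_eq_cat [:: (- u, v); (u, v)] _ [::] [::]) => //.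
apply: tens_eq_trans (tens_eq_0 v); apply: tens_eq_sym.
by have := tens_eq_Dl (- u) u v; rewrite addNr.
Qed.

HB.instance Definition _ :=
  GRing.isZmodule.Build tens tens_addA tens_addC tens_add0 tens_addN.

Lemma tens_piD s t : \pi_tens (s ++ t) = \pi_tens s + \pi_tens t.
Proof. by rewrite -tens_pi_add. Qed.

Fact tens_scaleA a b (x : tens) :
  tens_scale a (tens_scale b x) = tens_scale (a * b) x.
Proof.
elim/quotW: x => s; rewrite (tens_pi_scale b) !tens_pi_scale /tens_map.
by rewrite -map_comp; congr (\pi _); apply: eq_map => p /=; rewrite scalerA.
Qed.

Fact tens_scale1 : left_id 1 tens_scale.
Proof.
elim/quotW=> s; rewrite tens_pi_scale /tens_map; congr (\pi _).
by rewrite -[RHS]map_id; apply: eq_map => -[u v] /=; rewrite scale1r.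
Qed.

Fact tens_scaleDr : right_distributive tens_scale +%R.
Proof.
move=> c; elim/quotW=> s; elim/quotW=> t.
by rewrite -tens_piD (tens_pi_scale c s) (tens_pi_scale c t) tens_pi_scale
  -tens_piD /tens_map map_cat.
Qed.

Fact tens_scaleDl (x : tens) : {morph tens_scale^~ x : a b / a + b}.
Proof.
move=> a b /=; elim/quotW: x => s; rewrite !tens_pi_scale.
elim: s => [|[u v] s IH] /=; first by rewrite -tens_piD.
rewrite -(cat1s _ (tens_map _ s)) -(cat1s (a *: u, v)) -(cat1s (b *: u, v)).
rewrite !tens_piD IH addrACA; congr (_ + _).
by rewrite -tens_piD scalerDl; apply/tens_piP; apply: tens_eq_Dl.
Qed.

HB.instance Definition _ := GRing.Zmodule_isLmodule.Build k tens
  tens_scaleA tens_scale1 tens_scaleDr tens_scaleDl.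

Lemma pureDl u u' v : pure (u + u') v = pure u v + pure u' v.
Proof. by rewrite -tens_piD; apply/tens_piP; apply: tens_eq_Dl. Qed.

Lemma pureDr u v v' : pure u (v + v') = pure u v + pure u v'.
Proof. by rewrite -tens_piD; apply/tens_piP; apply: tens_eq_Dr. Qed.

Lemma pureZl c u v : pure (c *: u) v = c *: pure u v.
Proof. exact/esym/tens_pi_scale. Qed.

Lemma pure_bal s u v : pure (l s u) v = pure u (r s v).
Proof. by apply/tens_piP; apply: tens_eq_bal. Qed.

(** Sweedler sums: [\tsum_(a, b <- t) f a b] picks an expression of [t] as a sum
    of pure tensors and sums [f] over it.  The value does not depend on that
    choice as soon as [f] is balanced, see [tsum_pure] and [tsumD]. *)
Definition tsum (W : zmodType) (t : tens) (f : U -> V -> W) : W :=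
  \sum_(p <- repr t) f p.1 p.2.

Record balanced (W : zmodType) (f : U -> V -> W) : Prop := Balanced {
  balDl : forall u u' v, f (u + u') v = f u v + f u' v;
  balDr : forall u v v', f u (v + v') = f u v + f u v';
  balS : forall s u v, f (l s u) v = f u (r s v) }.

Lemma sum_tens_eq (W : zmodType) (f : U -> V -> W) s t : balanced f ->
  tens_eq s t -> \sum_(p <- s) f p.1 p.2 = \sum_(p <- t) f p.1 p.2.
Proof.
move=> bf; elim=> {s t} //.
- by move=> s t w _ -> _ ->.
- by move=> s t s' t' _ IH _ IH'; rewrite !big_cat /= IH IH'.
- by move=> s t; rewrite !big_cat /= addrC.
- move=> v; rewrite big_seq1 big_nil /=.
  by apply: (addrI (f 0 v)); rewrite -(balDl bf) !addr0.
- by move=> u u' v; rewrite !big_cons !big_nil /= !addr0 (balDl bf).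
- by move=> u v v'; rewrite !big_cons !big_nil /= !addr0 (balDr bf).
- by move=> z u v; rewrite !big_seq1 /= (balS bf).
Qed.

Lemma tsum_pi (W : zmodType) (f : U -> V -> W) s : balanced f ->
  tsum (\pi_tens s) f = \sum_(p <- s) f p.1 p.2.
Proof. by move=> bf; apply: sum_tens_eq => //; apply: tens_reprP. Qed.

Lemma tsum_pure (W : zmodType) (f : U -> V -> W) u v : balanced f ->
  tsum (pure u v) f = f u v.
Proof. by move=> bf; rewrite tsum_pi // big_seq1. Qed.

Lemma tsumD (W : zmodType) (f : U -> V -> W) t t' : balanced f ->
  tsum (t + t') f = tsum t f + tsum t' f.
Proof.
by move=> bf; rewrite -[t]reprK -[t']reprK -tens_piD !tsum_pi ?big_cat.
Qed.

Lemma tsum0 (W : zmodType) (f : U -> V -> W) : balanced f -> tsum 0 f = 0.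
Proof. by move=> bf; apply: (addrI (tsum 0 f)); rewrite -tsumD // !addr0. Qed.

Lemma tsumZ (W : lmodType k) (f : U -> V -> W) c t : balanced f ->
  (forall u v, f (c *: u) v = c *: f u v) -> tsum (c *: t) f = c *: tsum t f.
Proof.
move=> bf fZ; rewrite -[t]reprK -[c *: _]/(tens_scale _ _) tens_pi_scale.
by rewrite !tsum_pi // big_map scaler_sumr; apply: eq_bigr => p _; apply: fZ.
Qed.

Lemma tens_sumE t : tsum t pure = t.
Proof.
rewrite -[RHS]reprK /tsum; elim: (repr t) => [|p s IH]; first by rewrite big_nil.
by rewrite big_cons IH -tens_piD; case: p.
Qed.

Lemma tens_ind (P : tens -> Prop) : P 0 -> (forall u v, P (pure u v)) ->
  (forall x y, P x -> P y -> P (x + y)) -> forall t, P t.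
Proof. by move=> P0 Pp PD t; rewrite -[t]tens_sumE; apply: big_ind. Qed.

Lemma eq_tsum (W : zmodType) t (f g : U -> V -> W) :
  (forall u v, f u v = g u v) -> tsum t f = tsum t g.
Proof. by move=> fg; apply: eq_bigr => p _. Qed.

End Tensor.

Arguments tsum {k S U V l r W}.
Arguments pure {k S U V} l r u v.


Definition kscale (k : fieldType) (U : lmodType k) (c : k) : {linear U -> U} :=
  *:%R c.

Notation ktens U V := (tens (@kscale _ U) (@kscale _ V)).
Notation "u \ot v" := (pure (@kscale _ _) (@kscale _ _) u v) : ring_scope.
Notation "\tsum_ ( a , b <- t ) E" := (tsum t (fun a b => E)) : ring_scope.

Record hopf_algebra (k : fieldType) (H : algType k) := HopfAlgebra {
  comul : H -> ktens H H;
  counit : H -> k;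
  antipode : H -> H;
  comul_linear : linear comul;
  counit_linear : scalar counit;
  antipode_linear : linear antipode;
  comul1 : comul 1 = 1 \ot 1;
  comulM : forall g h, comul (g * h) =
    \tsum_(g1, g2 <- comul g) \tsum_(h1, h2 <- comul h) ((g1 * h1) \ot (g2 * h2));
  counit1 : counit 1 = 1;
  counitM : forall g h, counit (g * h) = counit g * counit h;
  comulA : forall h,
    \tsum_(h1, h2 <- comul h) (comul h1 \ot h2) =
    \tsum_(h1, h2 <- comul h) \tsum_(h3, h4 <- comul h2) ((h1 \ot h3) \ot h4);
  comul_counitl : forall h, \tsum_(h1, h2 <- comul h) (counit h1 *: h2) = h;
  comul_counitr : forall h, \tsum_(h1, h2 <- comul h) (counit h2 *: h1) = h;
  antipodel : forall h, \tsum_(h1, h2 <- comul h) (antipode h1 * h2) = (counit h)%:A;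
  antipoder : forall h, \tsum_(h1, h2 <- comul h) (h1 * antipode h2) = (counit h)%:A }.

Record comodule (k : fieldType) (H : algType k) (HH : hopf_algebra H)
    (M : lmodType k) := Comodule {
  coact : M -> ktens M H;
  coact_linear : linear coact;
  coactA : forall m,
    \tsum_(m0, m1 <- coact m) (coact m0 \ot m1) =
    \tsum_(m0, m1 <- coact m) \tsum_(h1, h2 <- comul HH m1) ((m0 \ot h1) \ot h2);
  coact_counit : forall m, \tsum_(m0, m1 <- coact m) (counit HH m1 *: m0) = m }.

Definition coinv (k : fieldType) (H : algType k) (HH : hopf_algebra H)
    (M : lmodType k) (C : comodule HH M) (m : M) : Prop :=
  coact C m = m \ot 1.

Definition colinear (k : fieldType) (H : algType k) (HH : hopf_algebra H)
    (M N : lmodType k) (C : comodule HH M) (D : comodule HH N) (f : M -> N) : Prop :=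
  forall m, coact D (f m) = \tsum_(m0, m1 <- coact C m) (f m0 \ot m1).

Definition regular_comodule (k : fieldType) (H : algType k)
    (HH : hopf_algebra H) : comodule HH H :=
  Comodule (comul_linear HH) (comulA HH) (comul_counitr HH).

Definition trilinear (k : fieldType) (U V W X : lmodType k)
    (f : U -> V -> W -> X) : Prop :=
  [/\ forall v w, linear (fun u => f u v w),
      forall u w, linear (fun v => f u v w)
    & forall u v, linear (f u v)].

Record lie3 (k : fieldType) (A : lmodType k) := Lie3 {
  br : A -> A -> A -> A;
  br_trilinear : trilinear br;
  br_skewl : forall x y z, br x y z = - br y x z;
  br_skewr : forall x y z, br x y z = - br x z y;
  br_jacobi : forall x y z u v, br (br x y z) u v =
    br (br x u v) y z + br (br y u v) z x + br (br z u v) x y }.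

Record lie3_module (k : fieldType) (A : lmodType k) (L : lie3 A)
    (M : lmodType k) := Lie3Module {
  dia : A -> A -> M -> M;
  dia_trilinear : trilinear dia;
  dia_skew : forall x y m, dia x y m = - dia y x m;
  dia_comm : forall x y u v m, dia x y (dia u v m) - dia u v (dia x y m) =
    dia (br L x y u) v m + dia u (br L x y v) m;
  dia_br : forall x y u v m, dia (br L x y u) v m =
    dia y u (dia x v m) - dia x u (dia y v m) + dia x y (dia u v m) }.

Record poisson3 (k : fieldType) (A : comAlgType k) := Poisson3 {
  poisson3_lie3 :> lie3 A;
  br_leibniz : forall x y u v, br poisson3_lie3 x y (u * v) =
    u * br poisson3_lie3 x y v + br poisson3_lie3 x y u * v }.

Record poisson3_module (k : fieldType) (A : comAlgType k) (P : poisson3 A)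
    (M : lmodType k) := Poisson3Module {
  poisson3_module_lie3 :> lie3_module P M;
  act : A -> M -> M;
  act_linearl : forall m, linear (act^~ m);
  act_linearr : forall a, linear (act a);
  act1 : forall m, act 1 m = m;
  actM : forall a b m, act (a * b) m = act a (act b m);
  dia_mul : forall x y z m, dia poisson3_module_lie3 (x * y) z m =
    act x (dia poisson3_module_lie3 y z m) + act y (dia poisson3_module_lie3 x z m);
  dia_act : forall x y z m, dia poisson3_module_lie3 x y (act z m) =
    act (br P x y z) m + act z (dia poisson3_module_lie3 x y m) }.

Record comodule_poisson3 (k : fieldType) (H : algType k) (HH : hopf_algebra H)
    (A : comAlgType k) := ComodulePoisson3 {
  comodule_poisson3_poisson3 :> poisson3 A;
  comodule_poisson3_comodule :> comodule HH A;
  coact_one : coact comodule_poisson3_comodule 1 = 1 \ot 1;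
  coact_mul : forall a b, coact comodule_poisson3_comodule (a * b) =
    \tsum_(a0, a1 <- coact comodule_poisson3_comodule a)
    \tsum_(b0, b1 <- coact comodule_poisson3_comodule b)
      ((a0 * b0) \ot (a1 * b1));
  coact_br : forall x y z,
    coact comodule_poisson3_comodule (br comodule_poisson3_poisson3 x y z) =
    \tsum_(x0, x1 <- coact comodule_poisson3_comodule x)
    \tsum_(y0, y1 <- coact comodule_poisson3_comodule y)
    \tsum_(z0, z1 <- coact comodule_poisson3_comodule z)
      (br comodule_poisson3_poisson3 x0 y0 z0 \ot (x1 * y1 * z1)) }.

Record hopf_poisson3_module (k : fieldType) (H : algType k)
    (HH : hopf_algebra H) (A : comAlgType k) (P : comodule_poisson3 HH A)
    (M : lmodType k) := HopfPoisson3Module {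
  hopf_poisson3_module_module :> poisson3_module P M;
  hopf_poisson3_module_comodule :> comodule HH M;
  coact_act : forall a m,
    coact hopf_poisson3_module_comodule (act hopf_poisson3_module_module a m) =
    \tsum_(a0, a1 <- coact P a)
    \tsum_(m0, m1 <- coact hopf_poisson3_module_comodule m)
      (act hopf_poisson3_module_module a0 m0 \ot (a1 * m1));
  coact_dia : forall x y m,
    coact hopf_poisson3_module_comodule (dia hopf_poisson3_module_module x y m) =
    \tsum_(x0, x1 <- coact P x)
    \tsum_(y0, y1 <- coact P y)
    \tsum_(m0, m1 <- coact hopf_poisson3_module_comodule m)
      (dia hopf_poisson3_module_module x0 y0 m0 \ot (x1 * y1 * m1)) }.

Record hopf_poisson3_morphism (k : fieldType) (H : algType k)
    (HH : hopf_algebra H) (A : comAlgType k) (P : comodule_poisson3 HH A)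
    (M N : lmodType k) (PM : hopf_poisson3_module P M)
    (PN : hopf_poisson3_module P N) (f : M -> N) : Prop := HopfPoisson3Morphism {
  morphism_linear : linear f;
  morphism_act : forall a m, f (act PM a m) = act PN a (f m);
  morphism_dia : forall x y m, f (dia PM x y m) = dia PN x y (f m);
  morphism_colinear : colinear PM PN f }.

Definition hopf_poisson3_isomorphism (k : fieldType) (H : algType k)
    (HH : hopf_algebra H) (A : comAlgType k) (P : comodule_poisson3 HH A)
    (M N : lmodType k) (PM : hopf_poisson3_module P M)
    (PN : hopf_poisson3_module P N) (f : M -> N) : Prop :=
  hopf_poisson3_morphism PM PN f /\
  exists g : N -> M,
    [/\ hopf_poisson3_morphism PN PM g, cancel f g & cancel g f].

(** The invariants [A^A] and [M^A]. *)
Definition lie3_center (k : fieldType) (A : lmodType k) (L : lie3 A) (b : A) : Prop :=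
  forall x y, br L b x y = 0.

Definition lie3_inv (k : fieldType) (A : lmodType k) (L : lie3 A)
    (M : lmodType k) (D : lie3_module L M) (m : M) : Prop :=
  forall x y, dia D x y m = 0.


Lemma linear0P (k : fieldType) (U V : lmodType k) (f : U -> V) :
  linear f -> f 0 = 0.
Proof. by move=> fL; have := fL (-1) 0 0; rewrite !scaleN1r !addNr. Qed.

Lemma linearDP (k : fieldType) (U V : lmodType k) (f : U -> V) u v :
  linear f -> f (u + v) = f u + f v.
Proof. by move=> fL; have := fL 1 u v; rewrite !scale1r. Qed.

Lemma linearZP (k : fieldType) (U V : lmodType k) (f : U -> V) c u :
  linear f -> f (c *: u) = c *: f u.
Proof. by move=> fL; have := fL c u 0; rewrite (linear0P fL) !addr0. Qed.

Section RegularModule.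

Variables (k : fieldType) (A : comAlgType k).

Lemma mul_linearl (y : A) : linear (fun x : A => x * y).
Proof. by move=> c u v; rewrite mulrDl scalerAl. Qed.

Lemma mul_linearr (x : A) : linear (fun y : A => x * y).
Proof. by move=> c u v; rewrite mulrDr scalerAr. Qed.

Variable P : poisson3 A.

Lemma br_cycle a b c : br P a b c = br P c a b.
Proof. by rewrite br_skewr br_skewl opprK. Qed.

Lemma brNr a b c : br P a b (- c) = - br P a b c.
Proof. by case: (br_trilinear P) => _ _ /(_ a b)/linearZP Z; rewrite -!scaleN1r Z. Qed.

Fact regular_dia_comm x y u v m :
  br P x y (br P u v m) - br P u v (br P x y m) =
  br P (br P x y u) v m + br P u (br P x y v) m.
Proof.
rewrite (br_cycle x y (br P u v m)) br_jacobi (br_cycle x y u) (br_cycle x y v).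
rewrite (br_cycle u v (br P x y m)) (br_cycle x y m).
by rewrite (br_cycle (br P v x y) m u) addrK.
Qed.

Fact regular_dia_br x y u v m : br P (br P x y u) v m =
  br P y u (br P x v m) - br P x u (br P y v m) + br P x y (br P u v m).
Proof.
rewrite br_jacobi (br_cycle x y (br P u v m)) (br_cycle y u (br P x v m)).
by rewrite (br_skewl P x u) opprK (br_cycle u x).
Qed.

Definition regular_lie3_module : lie3_module P A :=
  Lie3Module (br_trilinear P) (br_skewl P) regular_dia_comm regular_dia_br.

Fact regular_dia_mul x y z m :
  br P (x * y) z m = x * br P y z m + y * br P x z m.
Proof.
have cyc a b : br P a z b = br P z b a by rewrite -br_cycle.
by rewrite !cyc br_leibniz [br P z m x * y]mulrC.
Qed.

Fact regular_dia_act x y z m :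
  br P x y (z * m) = br P x y z * m + z * br P x y m.
Proof. by rewrite br_leibniz addrC. Qed.

Definition regular_poisson3_module : poisson3_module P A :=
  @Poisson3Module _ _ P A regular_lie3_module *%R mul_linearl mul_linearr
    (@mul1r A) (fun a b m => esym (@mulrA A a b m)) regular_dia_mul regular_dia_act.

End RegularModule.

Definition regular_module (k : fieldType) (H : algType k) (HH : hopf_algebra H)
    (A : comAlgType k) (P : comodule_poisson3 HH A) : hopf_poisson3_module P A :=
  @HopfPoisson3Module _ _ _ _ P A (regular_poisson3_module P) P
    (coact_mul P) (coact_br P).

Section TsumLinear.

Variables (k : fieldType) (S : Type) (U V : lmodType k).
Variables (l : S -> {linear U -> U}) (r : S -> V -> V).
Implicit Types (W : lmodType k) (t : tens l r).

Lemma tsum_linear W (f : U -> V -> W) : balanced l r f ->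
  (forall v, linear (f^~ v)) -> linear (fun t => tsum t f).
Proof.
move=> bf fL c t t'; rewrite tsumD // tsumZ // => u v.
exact: (linearZP c u (fL v)).
Qed.

Lemma tsum_paraml (X W : lmodType k) (f : X -> U -> V -> W) t :
  (forall u v, linear (fun x => f x u v)) -> linear (fun x => tsum t (f x)).
Proof.
move=> fL c x y; rewrite /tsum scaler_sumr -big_split /=.
by apply: eq_bigr => p _; apply: fL.
Qed.

Lemma linear_tsum W (W' : lmodType k) (g : W -> W') (f : U -> V -> W) t :
  linear g -> g (tsum t f) = tsum t (fun u v => g (f u v)).
Proof.
move=> gL; apply: (big_morph g) => [x y|]; first exact: linearDP.
exact: linear0P.
Qed.

Lemma pure_linearl v : linear (fun u => pure l r u v).
Proof. by move=> c u u'; rewrite pureDl pureZl. Qed.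

Lemma linear_ext W (f g : tens l r -> W) : linear f -> linear g ->
  (forall u v, f (pure l r u v) = g (pure l r u v)) -> f =1 g.
Proof.
move=> fL gL fg; apply: tens_ind => //; first by rewrite !linear0P.
by move=> x y IHx IHy; rewrite !linearDP ?IHx ?IHy.
Qed.

End TsumLinear.

Section KtensLinear.

Variables (k : fieldType) (U V : lmodType k).
Implicit Types (W : lmodType k) (t : ktens U V).

Definition bilin W (f : U -> V -> W) : Prop :=
  (forall v, linear (f^~ v)) /\ (forall u, linear (f u)).

Lemma bilin_balanced W (f : U -> V -> W) : bilin f ->
  balanced (@kscale k U) (@kscale k V) f.
Proof.
move=> [fl fr]; split=> [u u' v|u v v'|c u v].
- exact: (linearDP u u' (fl v)).
- exact: linearDP.
- by rewrite (linearZP c u (fl v)) [RHS](linearZP c v (fr u)).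
Qed.

Lemma ktsum_linear W (f : U -> V -> W) : bilin f -> linear (fun t => tsum t f).
Proof. by move=> bf; apply: tsum_linear; [apply: bilin_balanced | case: bf]. Qed.

Lemma ktsum_pure W (f : U -> V -> W) u v : bilin f -> tsum (u \ot v) f = f u v.
Proof. by move=> bf; rewrite tsum_pure //; apply: bilin_balanced. Qed.

Lemma kpure_bilin : bilin (fun (u : U) (v : V) => u \ot v).
Proof.
split=> [v|u]; first exact: pure_linearl.
move=> c v v'; rewrite pureDr; congr (_ + _).
by rewrite -[c *: v]/(kscale V c v) -pure_bal -pureZl.
Qed.

Lemma kpure_linear_l (X : lmodType k) (g : X -> U) (v : V) :
  linear g -> linear (fun x => g x \ot v).
Proof. by move=> gL c x y; rewrite gL; apply: kpure_bilin.1. Qed.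

Lemma kpure_linear_r (X : lmodType k) (g : X -> V) (u : U) :
  linear g -> linear (fun x => u \ot g x).
Proof. by move=> gL c x y; rewrite gL; apply: kpure_bilin.2. Qed.

Lemma ktsum_comp (X W : lmodType k) (g : X -> ktens U V) (f : U -> V -> W) :
  linear g -> bilin f -> linear (fun x => tsum (g x) f).
Proof. by move=> gL bf c x y; rewrite gL; apply: ktsum_linear. Qed.

Lemma ktsum_tsum (S : Type) (X Y W : lmodType k) (l : S -> {linear X -> X})
    (r : S -> Y -> Y) (t : tens l r) (f : X -> Y -> ktens U V)
    (g : U -> V -> W) : bilin g ->
  tsum (tsum t f) g = tsum t (fun x y => tsum (f x y) g).
Proof. by move=> bg; apply: (linear_tsum f t (ktsum_linear bg)). Qed.

End KtensLinear.

Lemma linear_id (k : fieldType) (U : lmodType k) : linear (fun u : U => u).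
Proof. by []. Qed.

Section BilinPair.

Variables (k : fieldType) (X X' Y Z Z' T : lmodType k).
Variables (f : X -> X' -> Y) (g : Z -> Z' -> T).
Hypotheses (bf : bilin f) (bg : bilin g).

Lemma bilin_pairr x z : bilin (fun x' z' => f x x' \ot g z z').
Proof.
split=> [z'|x']; first by apply: kpure_linear_l; apply: bf.2.
by apply: kpure_linear_r; apply: bg.2.
Qed.

Lemma bilin_pairl (t : ktens X' Z') :
  bilin (fun x z => \tsum_(x', z' <- t) (f x x' \ot g z z')).
Proof.
split=> [z|x]; apply: tsum_paraml => x' z'.
  by apply: kpure_linear_l; apply: bf.1.
by apply: kpure_linear_r; apply: bg.1.
Qed.

Lemma pair_pure x z x' z' :
  \tsum_(x1, z1 <- x \ot z) \tsum_(x2, z2 <- x' \ot z') (f x1 x2 \ot g z1 z2) =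
  f x x' \ot g z z'.
Proof.
rewrite (ktsum_pure _ _ (bilin_pairl _)).
by rewrite (ktsum_pure _ _ (bilin_pairr _ _)).
Qed.

End BilinPair.

Section InvariantTensor.

Variables (k : fieldType) (H : algType k) (HH : hopf_algebra H).
Variables (A : comAlgType k) (P : comodule_poisson3 HH A).
Variables (M : lmodType k) (PM : hopf_poisson3_module P M).

(** Membership in [B = A^AcoH] and in [M^AcoH]. *)
Definition AcoH_inv (b : A) : Prop := lie3_center P b /\ coinv P b.
Definition McoH_inv (m : M) : Prop := lie3_inv PM m /\ coinv PM m.

Definition subAcoH := {b : A | AcoH_inv b}.

Definition McoH_pred : {pred M} := [pred m | `[< McoH_inv m >]].

Lemma McoH_predP m : reflect (McoH_inv m) (m \in McoH_pred).
Proof. by rewrite inE /=; apply: asboolP. Qed.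

Fact McoH_submod_closed : submod_closed McoH_pred.
Proof.
have lin x y : linear (dia PM x y) by case: (dia_trilinear PM).
have clin : linear (fun m : M => m \ot (1 : H)) by apply: pure_linearl.
split=> [|c m n /McoH_predP[mA mH] /McoH_predP[nA nH]]; apply/McoH_predP; split.
- by move=> x y; rewrite (linear0P (lin x y)).
- by rewrite /coinv (linear0P (coact_linear PM)) (linear0P clin).
- by move=> x y; rewrite lin mA nA scaler0 addr0.
- by rewrite /coinv coact_linear mH nH clin.
Qed.

HB.instance Definition _ :=
  GRing.isSubmodClosed.Build k M McoH_pred McoH_submod_closed.

Definition subMcoH := {m : M | m \in McoH_pred}.
HB.instance Definition _ := Choice.on subMcoH.
HB.instance Definition _ := SubChoice.on subMcoH.
HB.instance Definition _ := [SubChoice_isSubLmodule of subMcoH by <:].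

Lemma act_bilin : bilin (act PM).
Proof. by split; [apply: act_linearl | apply: act_linearr]. Qed.

Lemma mul_bilin (B : algType k) : bilin (fun x y : B => x * y).
Proof.
split=> [y c u v|x c u v]; first by rewrite mulrDl scalerAl.
by rewrite mulrDr scalerAr.
Qed.

Fact act_McoH_inv (b : subAcoH) (n : subMcoH) :
  act PM (sval b) (val n) \in McoH_pred.
Proof.
case: b n => b [bA bH] [n /= /McoH_predP[nA nH]]; apply/McoH_predP; split.
  move=> x y; rewrite dia_act nA (br_cycle P x y b) bA.
  by rewrite (linear0P (act_linearl PM n)) (linear0P (act_linearr PM b)) addr0.
by rewrite /coinv coact_act bH nH (pair_pure act_bilin (mul_bilin H)) mulr1.
Qed.

Definition mulB (b : subAcoH) (a : A) : A := a * sval b.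

Fact mulB_linear b : linear (mulB b).
Proof. exact: mul_linearl. Qed.

HB.instance Definition _ b := GRing.isLinear.Build k A A *:%R (mulB b)
  (mulB_linear b).

Definition actB (b : subAcoH) (n : subMcoH) : subMcoH :=
  exist _ (act PM (sval b) (val n)) (act_McoH_inv b n).

(** [A (x)_B M^AcoH] for [B = A^AcoH], with its Hopf-module operations given on
    pure tensors; [tensB_actE], [tensB_diaE] and [tensB_coactE] show that they
    are well defined. *)
Definition tensB := tens (fun b => mulB b) actB.
HB.instance Definition _ := GRing.Lmodule.on tensB.

Definition pureB (a : A) (m : subMcoH) : tensB := pure (fun b => mulB b) actB a m.
Local Notation "a \otB m" := (pureB a m) (at level 40, left associativity).

Definition tensB_act (x : A) (t : tensB) : tensB :=
  \tsum_(a, m <- t) ((x * a) \otB m).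
Definition tensB_dia (x y : A) (t : tensB) : tensB :=
  \tsum_(a, m <- t) (br P x y a \otB m).
Definition tensB_coact (t : tensB) : ktens tensB H :=
  \tsum_(a, m <- t) \tsum_(a0, a1 <- coact P a) ((a0 \otB m) \ot a1).

Definition alpha (t : tensB) : M := \tsum_(a, m <- t) act PM a (val m).

Lemma pureB_linearl m : linear (fun a => a \otB m).
Proof. exact: pure_linearl. Qed.

Lemma pureB_linear_comp (X : lmodType k) (g : X -> A) m :
  linear g -> linear (fun x => g x \otB m).
Proof. by move=> gL c x y; rewrite gL; apply: pureB_linearl. Qed.

Lemma pureB_bal (b : subAcoH) a m : (a * sval b) \otB m = a \otB actB b m.
Proof. exact: (@pure_bal _ _ _ _ (fun b => mulB b)). Qed.

Lemma br_linearr x y : linear (br P x y).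
Proof. by case: (br_trilinear P). Qed.

Fact tensB_act_balanced x :
  balanced (fun b => mulB b) actB (fun a m => (x * a) \otB m).
Proof.
split=> [u u' v|u v v'|b u v]; first by rewrite mulrDr; apply: pureDl.
  exact: pureDr.
by rewrite /= /mulB mulrA pureB_bal.
Qed.

Fact tensB_dia_balanced x y :
  balanced (fun b => mulB b) actB (fun a m => br P x y a \otB m).
Proof.
split=> [u u' v|u v v'|b u v].
- by rewrite (linearDP _ _ (br_linearr x y)); apply: pureDl.
- exact: pureDr.
have [/(_ x y) bA _] := svalP b.
by rewrite /= /mulB br_leibniz (br_cycle P x y (sval b)) bA mulr0 add0r pureB_bal.
Qed.

Lemma pureB_pair_bilin m :
  bilin (fun (a0 : A) (a1 : H) => (a0 \otB m) \ot a1).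
Proof.
split=> [h|a]; first exact: kpure_linear_l (pureB_linearl m).
exact: kpure_linear_r (@linear_id _ _).
Qed.

Fact tensB_coact_balanced : balanced (fun b => mulB b) actB
  (fun a m => \tsum_(a0, a1 <- coact P a) ((a0 \otB m) \ot a1)).
Proof.
have cL m := ktsum_comp (coact_linear P) (pureB_pair_bilin m).
split=> [u u' m|u m m'|b u m].
- exact: (linearDP _ _ (cL m)).
- rewrite /tsum -big_split; apply: eq_bigr => p _ /=.
  by rewrite /pureB pureDr pureDl.
have [_ bH] := svalP b.
rewrite /= /mulB coact_mul bH (ktsum_tsum _ _ (pureB_pair_bilin m)).
apply: eq_tsum => a0 a1.
have bB : bilin (fun b0 (b1 : H) => (a0 * b0 : A) \ot (a1 * b1)).
  exact: (bilin_pairr (mul_bilin A) (mul_bilin H)).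
rewrite (ktsum_pure _ _ bB) (ktsum_pure _ _ (pureB_pair_bilin m)) mulr1.
by rewrite pureB_bal.
Qed.

Lemma tensB_act_linear x : linear (tensB_act x).
Proof.
apply: tsum_linear (tensB_act_balanced x) _ => m.
exact: pureB_linear_comp (mul_linearr x).
Qed.

Lemma tensB_dia_linear x y : linear (tensB_dia x y).
Proof.
apply: tsum_linear (tensB_dia_balanced x y) _ => m.
exact: pureB_linear_comp (br_linearr x y).
Qed.

Lemma tensB_coact_linear : linear tensB_coact.
Proof.
apply: tsum_linear tensB_coact_balanced _ => m.
exact: ktsum_comp (coact_linear P) (pureB_pair_bilin m).
Qed.

Lemma tensB_actE x a m : tensB_act x (a \otB m) = (x * a) \otB m.
Proof. exact: tsum_pure (tensB_act_balanced x). Qed.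

Lemma tensB_diaE x y a m : tensB_dia x y (a \otB m) = br P x y a \otB m.
Proof. exact: tsum_pure (tensB_dia_balanced x y). Qed.

Lemma tensB_coactE a m : tensB_coact (a \otB m) =
  \tsum_(a0, a1 <- coact P a) ((a0 \otB m) \ot a1).
Proof. exact: tsum_pure tensB_coact_balanced. Qed.

Lemma tensB_ext (W : lmodType k) (f g : tensB -> W) : linear f -> linear g ->
  (forall a m, f (a \otB m) = g (a \otB m)) -> f =1 g.
Proof. exact: linear_ext. Qed.

Lemma linear_comp (X Y Z : lmodType k) (f : Y -> Z) (g : X -> Y) :
  linear f -> linear g -> linear (fun x => f (g x)).
Proof. by move=> fL gL c x y; rewrite gL fL. Qed.

Lemma linear_add (X Y : lmodType k) (f g : X -> Y) :
  linear f -> linear g -> linear (fun x => f x + g x).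
Proof. by move=> fL gL c x y; rewrite fL gL scalerDr addrACA. Qed.

Lemma linear_opp (X Y : lmodType k) (f : X -> Y) :
  linear f -> linear (fun x => - f x).
Proof. by move=> fL c x y; rewrite fL opprD scalerN. Qed.

Fact tensB_dia_trilinear : trilinear tensB_dia.
Proof.
have [brl brm _] := br_trilinear P.
split=> [y t|x t|x y]; last exact: tensB_dia_linear.
  by apply: tsum_paraml => a m; apply: (pureB_linear_comp m (brl y a)).
by apply: tsum_paraml => a m; apply: (pureB_linear_comp m (brm x a)).
Qed.

Local Ltac tensB_lin :=
  repeat first [ exact: linear_id | exact: tensB_dia_linear
               | exact: tensB_act_linear | exact: tensB_coact_linear
               | apply: linear_add | apply: linear_opp
               | apply: (linear_comp (tensB_dia_linear _ _))
               | apply: (linear_comp (tensB_act_linear _)) ].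

Fact tensB_dia_skew x y t : tensB_dia x y t = - tensB_dia y x t.
Proof.
move: t; apply: tensB_ext; tensB_lin => a m.
rewrite !tensB_diaE br_skewl.
by rewrite -scaleN1r (linearZP _ _ (pureB_linearl m)) scaleN1r.
Qed.

Lemma pureB_sub a b m : a \otB m - b \otB m = (a - b) \otB m.
Proof.
have L := pureB_linearl m.
by rewrite -!scaleN1r -(linearZP _ _ L) -(linearDP _ _ L).
Qed.

Lemma pureB_add a b m : a \otB m + b \otB m = (a + b) \otB m.
Proof. by rewrite -(linearDP _ _ (pureB_linearl m)). Qed.

Fact tensB_dia_comm x y u v t :
  tensB_dia x y (tensB_dia u v t) - tensB_dia u v (tensB_dia x y t) =
  tensB_dia (br P x y u) v t + tensB_dia u (br P x y v) t.
Proof.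
move: t; apply: tensB_ext; tensB_lin => a m.
by rewrite !tensB_diaE pureB_sub pureB_add regular_dia_comm.
Qed.

Fact tensB_dia_br x y u v t : tensB_dia (br P x y u) v t =
  tensB_dia y u (tensB_dia x v t) - tensB_dia x u (tensB_dia y v t) +
  tensB_dia x y (tensB_dia u v t).
Proof.
move: t; apply: tensB_ext; tensB_lin => a m.
by rewrite !tensB_diaE pureB_sub pureB_add regular_dia_br.
Qed.

Definition tensB_lie3_module : lie3_module P tensB :=
  Lie3Module tensB_dia_trilinear tensB_dia_skew tensB_dia_comm tensB_dia_br.

Fact tensB_act_linearl t : linear (tensB_act^~ t).
Proof.
by apply: tsum_paraml => a m; apply: (pureB_linear_comp m (mul_linearl a)).
Qed.

Fact tensB_act1 t : tensB_act 1 t = t.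
Proof. by move: t; apply: tensB_ext; tensB_lin => a m; rewrite tensB_actE mul1r. Qed.

Fact tensB_actM x y t : tensB_act (x * y) t = tensB_act x (tensB_act y t).
Proof. by move: t; apply: tensB_ext; tensB_lin => a m; rewrite !tensB_actE mulrA. Qed.

Fact tensB_dia_mul x y z t : tensB_dia (x * y) z t =
  tensB_act x (tensB_dia y z t) + tensB_act y (tensB_dia x z t).
Proof.
move: t; apply: tensB_ext; tensB_lin => a m.
by rewrite !tensB_diaE !tensB_actE pureB_add regular_dia_mul.
Qed.

Fact tensB_dia_act x y z t : tensB_dia x y (tensB_act z t) =
  tensB_act (br P x y z) t + tensB_act z (tensB_dia x y t).
Proof.
move: t; apply: tensB_ext; tensB_lin => a m.
by rewrite !tensB_diaE !tensB_actE tensB_diaE pureB_add regular_dia_act.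
Qed.

Definition tensB_poisson3_module : poisson3_module P tensB :=
  @Poisson3Module _ _ P tensB tensB_lie3_module tensB_act tensB_act_linearl
    tensB_act_linear tensB_act1 tensB_actM tensB_dia_mul tensB_dia_act.

Fact tensB_coactA t :
  \tsum_(t0, t1 <- tensB_coact t) (tensB_coact t0 \ot t1) =
  \tsum_(t0, t1 <- tensB_coact t) \tsum_(h1, h2 <- comul HH t1)
    ((t0 \ot h1) \ot h2).
Proof.
have bl : bilin (fun t0 (t1 : H) => tensB_coact t0 \ot t1).
  split=> [h|u]; first exact: kpure_linear_l tensB_coact_linear.
  exact: kpure_linear_r (@linear_id _ _).
have bh (U : lmodType k) (u : U) : bilin (fun h1 h2 : H => (u \ot h1) \ot h2).
  split=> [h|h']; first exact: kpure_linear_l (kpure_linear_r _ (@linear_id _ _)).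
  exact: kpure_linear_r (@linear_id _ _).
have br (U : lmodType k) : bilin (fun (t0 : U) (t1 : H) =>
    \tsum_(h1, h2 <- comul HH t1) ((t0 \ot h1) \ot h2)).
  split=> [h|u]; last exact: ktsum_comp (comul_linear HH) (bh U u).
  apply: tsum_paraml => h1 h2.
  exact: kpure_linear_l (kpure_linear_l _ (@linear_id _ _)).
move: t; apply: tensB_ext.
- exact: ktsum_comp tensB_coact_linear bl.
- exact: ktsum_comp tensB_coact_linear (br _).
move=> a m; rewrite !tensB_coactE !ktsum_tsum //.
have bG1 := pureB_pair_bilin m.
pose G1 (w : ktens A H) := \tsum_(a0, a1 <- w) ((a0 \otB m) \ot a1).
have bG : bilin (fun w (h : H) => G1 w \ot h).
  split=> [h|w]; first exact: kpure_linear_l (ktsum_linear bG1).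
  exact: kpure_linear_r (@linear_id _ _).
have := congr1 (fun z : ktens (ktens A H) H => tsum z (fun w h => G1 w \ot h))
  (coactA P a).
rewrite !(ktsum_tsum _ _ bG) => eqA.
transitivity (\tsum_(a0, a1 <- coact P a)
  (\tsum_(w, h <- coact P a0 \ot a1) (G1 w \ot h))).
  by apply: eq_tsum => a0 a1; rewrite !ktsum_pure // tensB_coactE.
rewrite eqA; apply: eq_tsum => a0 a1.
rewrite (ktsum_tsum _ _ bG) (ktsum_pure _ _ (br _)).
by apply: eq_tsum => h1 h2; rewrite !ktsum_pure // /G1 ktsum_pure.
Qed.

Fact tensB_coact_counit t :
  \tsum_(t0, t1 <- tensB_coact t) (counit HH t1 *: t0) = t.
Proof.
have be (U : lmodType k) : bilin (fun (u : U) (h : H) => counit HH h *: u).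
  split=> [h c u v|u c g h]; first by rewrite scalerDr !scalerA mulrC.
  by rewrite counit_linear scalerDl scalerA.
move: t; apply: tensB_ext => [||a m].
- exact: ktsum_comp tensB_coact_linear (be _).
- exact: linear_id.
rewrite tensB_coactE ktsum_tsum // -[in RHS](coact_counit P a).
have L := pureB_linearl m; rewrite (linear_tsum _ _ L).
by apply: eq_tsum => a0 a1; rewrite ktsum_pure // (linearZP _ _ L).
Qed.

Definition tensB_comodule : comodule HH tensB :=
  Comodule tensB_coact_linear tensB_coactA tensB_coact_counit.

Fact tensB_coact_act x t : tensB_coact (tensB_act x t) =
  \tsum_(x0, x1 <- coact P x) \tsum_(t0, t1 <- tensB_coact t)
    (tensB_act x0 t0 \ot (x1 * t1)).
Proof.
have bp x0 x1 : bilin (fun t0 (t1 : H) => tensB_act x0 t0 \ot (x1 * t1)).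
  by apply: (@bilin_pairr _ _ _ _ _ _ _ tensB_act) (mul_bilin H) x0 x1;
    split; [apply: tensB_act_linearl | apply: tensB_act_linear].
move: t; apply: tensB_ext => [||a m].
- exact: linear_comp tensB_coact_linear (tensB_act_linear x).
- apply: tsum_paraml => x0 x1.
  exact: ktsum_comp tensB_coact_linear (bp x0 x1).
rewrite tensB_actE !tensB_coactE coact_mul.
have bG1 := pureB_pair_bilin m.
rewrite (ktsum_tsum _ _ bG1); apply: eq_tsum => x0 x1.
rewrite (ktsum_tsum _ _ bG1) (ktsum_tsum _ _ (bp _ _)); apply: eq_tsum => a0 a1.
by rewrite (ktsum_pure _ _ bG1) (ktsum_pure _ _ (bp _ _)) tensB_actE.
Qed.

Fact tensB_coact_dia x y t : tensB_coact (tensB_dia x y t) =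
  \tsum_(x0, x1 <- coact P x) \tsum_(y0, y1 <- coact P y)
  \tsum_(t0, t1 <- tensB_coact t) (tensB_dia x0 y0 t0 \ot (x1 * y1 * t1)).
Proof.
have bp x0 y0 (h : H) : bilin (fun t0 (t1 : H) => tensB_dia x0 y0 t0 \ot (h * t1)).
  split=> [h'|t0]; first exact: kpure_linear_l (tensB_dia_linear x0 y0).
  by apply: kpure_linear_r; apply: (mul_bilin H).2.
move: t; apply: tensB_ext => [||a m].
- exact: linear_comp tensB_coact_linear (tensB_dia_linear x y).
- apply: tsum_paraml => x0 x1; apply: tsum_paraml => y0 y1.
  exact: ktsum_comp tensB_coact_linear (bp x0 y0 _).
rewrite tensB_diaE !tensB_coactE coact_br.
have bG1 := pureB_pair_bilin m.
rewrite (ktsum_tsum _ _ bG1); apply: eq_tsum => x0 x1.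
rewrite (ktsum_tsum _ _ bG1); apply: eq_tsum => y0 y1.
rewrite (ktsum_tsum _ _ bG1) (ktsum_tsum _ _ (bp _ _ _)).
apply: eq_tsum => a0 a1.
by rewrite (ktsum_pure _ _ bG1) (ktsum_pure _ _ (bp _ _ _)) tensB_diaE.
Qed.

Definition tensB_module : hopf_poisson3_module P tensB :=
  @HopfPoisson3Module _ _ _ _ P tensB tensB_poisson3_module tensB_comodule
    tensB_coact_act tensB_coact_dia.

End InvariantTensor.

(** [p_M] and [(x, y) <>' m].  [Sinv] stands for the inverse of the antipode. *)
Definition proj (k : fieldType) (H : algType k) (HH : hopf_algebra H)
    (A : comAlgType k) (P : comodule_poisson3 HH A) (M : lmodType k)
    (PM : hopf_poisson3_module P M) (Sinv : H -> H) (phi : H -> A) (m : M) : M :=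
  \tsum_(m0, m1 <- coact PM m) act PM (phi (Sinv m1)) m0.

Definition proj_dia (k : fieldType) (H : algType k) (HH : hopf_algebra H)
    (A : comAlgType k) (P : comodule_poisson3 HH A) (M : lmodType k)
    (PM : hopf_poisson3_module P M) (Sinv : H -> H) (phi : H -> A)
    (x y : A) (m : M) : M :=
  proj PM Sinv phi (dia PM x y m).

(* Main.v *)
(* The projection [p m = phi (S^-1 m_1) . m_0] takes values in [M^coH], and
   [m = phi (m_1) . p m_0] for all [m].  Applied to [(x, y) <> m] with [m]
   coinvariant, whose coaction is [(x_0, y_0) <> m (x) x_1 y_1], this formula
   reads [(x, y) <> m = phi (x_1 y_1) . ((x_0, y_0) <>' m) = 0]; hence
   [M^coH] is contained in [M^A], and likewise for [A].  So [p] maps [M] to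
   [M^AcoH] and [A] to [B], and [m |-> phi (m_1) (x)_B p m_0] is inverse to
   [alpha], because [p (a . m) = p a . m] for coinvariant [m]. *)
Require Import Defs.
From mathcomp Require Import all_boot all_order all_algebra.

Set Implicit Arguments.
Unset Strict Implicit.
Unset Printing Implicit Defensive.

Import GRing.Theory.
Local Open Scope ring_scope.

(** * Sweedler sums and linearity *)

Lemma exchange_tsum (k : fieldType) (S S' : Type) (U V U' V' : lmodType k)
    (l : S -> {linear U -> U}) (r : S -> V -> V)
    (l' : S' -> {linear U' -> U'}) (r' : S' -> V' -> V') (W : zmodType)
    (t : tens l r) (t' : tens l' r') (f : U -> V -> U' -> V' -> W) :
  \tsum_(u, v <- t) \tsum_(u', v' <- t') f u v u' v' =
  \tsum_(u', v' <- t') \tsum_(u, v <- t) f u v u' v'.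
Proof. exact: exchange_big. Qed.

Lemma tsum_eq0 (k : fieldType) (S : Type) (U V : lmodType k)
    (l : S -> {linear U -> U}) (r : S -> V -> V) (W : zmodType)
    (t : tens l r) (f : U -> V -> W) :
  (forall u v, f u v = 0) -> tsum t f = 0.
Proof. by move=> f0; apply: big1 => p _; apply: f0. Qed.

Lemma linear_can (k : fieldType) (U V : lmodType k) (f : U -> V) (g : V -> U) :
  linear f -> cancel f g -> cancel g f -> linear g.
Proof. by move=> fL fK gK c u v; apply: (can_inj fK); rewrite fL !gK. Qed.

Lemma linear_rmorph (k : fieldType) (U V : algType k) (f : {lrmorphism U -> V}) :
  linear f.
Proof. exact: linearP. Qed.

Lemma linear_scaler (k : fieldType) (U V : lmodType k) (c : k) (f : U -> V) :
  linear f -> linear (fun u => c *: f u).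
Proof. by move=> fL d u u'; rewrite fL scalerDr !scalerA mulrC. Qed.

(* [lin_base] is a hook, redefined where further linear maps are available. *)
Ltac lin_base := fail.
Ltac lin :=
  cbv beta;
  lazymatch goal with
  | |- bilin _ => split=> ?; lin
  | |- trilinear _ => split=> ? ?; lin
  | |- _ => first
    [ solve [exact: linear_id]
    | solve [assumption]
    | solve [lin_base]
    | solve [apply: (linear_comp (comul_linear _)); lin]
    | solve [apply: (linear_comp (antipode_linear _)); lin]
    | solve [apply: (linear_comp (coact_linear _)); lin]
    | solve [apply: (linear_comp ((mul_bilin _).1 _)); lin]
    | solve [apply: (linear_comp ((mul_bilin _).2 _)); lin]
    | solve [apply: (linear_comp (@linear_rmorph _ _ _ _)); lin]
    | solve [apply: (linear_comp ((act_bilin _).1 _)); lin]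
    | solve [apply: (linear_comp ((act_bilin _).2 _)); lin]
    | solve [apply: linear_scaler; lin]
    | solve [apply: kpure_linear_l; lin]
    | solve [apply: kpure_linear_r; lin]
    | solve [apply: tsum_paraml => ? ?; lin]
    | solve [apply: ktsum_comp; lin] ]
  end.

(** * Coassociativity, the antipode and its inverse *)

Section Sweedler.

Variables (k : fieldType) (H : algType k) (HH : hopf_algebra H).

(** Trilinearity makes [f] factor through the iterated tensor product, so it can be applied to both
    sides of the coassociativity axiom. *)
Lemma coact_assoc (M : lmodType k) (C : comodule HH M) (W : lmodType k)
    (f : M -> H -> H -> W) m : trilinear f ->
  \tsum_(m0, m1 <- coact C m) \tsum_(n0, n1 <- coact C m0) f n0 n1 m1 =
  \tsum_(m0, m1 <- coact C m) \tsum_(h1, h2 <- comul HH m1) f m0 h1 h2.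
Proof.
move=> [f1 f2 f3].
have b12 h : bilin (fun n g => f n g h) by [].
have bF : bilin (fun (w : ktens M H) h => \tsum_(n, g <- w) f n g h).
  split=> [h|w]; first exact: ktsum_linear.
  exact: tsum_paraml.
have := congr1 (fun t : ktens (ktens M H) H =>
  \tsum_(w, h <- t) \tsum_(n, g <- w) f n g h) (coactA C m).
rewrite !(ktsum_tsum _ _ bF) => eqA.
transitivity (\tsum_(m0, m1 <- coact C m) \tsum_(w, h <- coact C m0 \ot m1)
  \tsum_(n, g <- w) f n g h).
  by apply: eq_tsum => m0 m1; rewrite (ktsum_pure _ _ bF).
rewrite eqA; apply: eq_tsum => m0 m1.
rewrite (ktsum_tsum _ _ bF); apply: eq_tsum => h1 h2.
by rewrite (ktsum_pure _ _ bF) (ktsum_pure _ _ (b12 _)).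
Qed.

Lemma comul_assoc (W : lmodType k) (f : H -> H -> H -> W) h : trilinear f ->
  \tsum_(h1, h2 <- comul HH h) \tsum_(g1, g2 <- comul HH h1) f g1 g2 h2 =
  \tsum_(h1, h2 <- comul HH h) \tsum_(g1, g2 <- comul HH h2) f h1 g1 g2.
Proof. exact: (@coact_assoc H (regular_comodule HH)). Qed.

Lemma coact_counit_linear (M W : lmodType k) (C : comodule HH M) (f : M -> W) m :
  linear f -> \tsum_(m0, m1 <- coact C m) (counit HH m1 *: f m0) = f m.
Proof.
move=> fL; rewrite -[in RHS](coact_counit C m) (linear_tsum _ _ fL).
by apply: eq_tsum => m0 m1; rewrite (linearZP _ _ fL).
Qed.

Lemma comul_counitr_linear (W : lmodType k) (f : H -> W) h :
  linear f -> \tsum_(h1, h2 <- comul HH h) (counit HH h2 *: f h1) = f h.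
Proof. exact: (@coact_counit_linear H W (regular_comodule HH)). Qed.

Lemma comul_counitl_linear (W : lmodType k) (f : H -> W) h :
  linear f -> \tsum_(h1, h2 <- comul HH h) (counit HH h1 *: f h2) = f h.
Proof.
move=> fL; rewrite -[in RHS](comul_counitl HH h) (linear_tsum _ _ fL).
by apply: eq_tsum => m0 m1; rewrite (linearZP _ _ fL).
Qed.

Lemma tsum_comulM (W : lmodType k) (f : H -> H -> W) g h : bilin f ->
  \tsum_(x, y <- comul HH (g * h)) f x y =
  \tsum_(g1, g2 <- comul HH g) \tsum_(h1, h2 <- comul HH h)
    f (g1 * h1) (g2 * h2).
Proof.
move=> bf; rewrite comulM (ktsum_tsum _ _ bf); apply: eq_tsum => g1 g2.
rewrite (ktsum_tsum _ _ bf); apply: eq_tsum => h1 h2.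
exact: ktsum_pure.
Qed.

Local Notation S := (antipode HH).

Lemma antipode1 : S 1 = 1.
Proof.
have := antipodel HH 1; rewrite comul1 ktsum_pure; last by lin.
by rewrite mulr1 counit1 scale1r.
Qed.

(** Comultiplication is multiplicative, so this is the antipode axiom at [g * h]. With
    [antipode_mulr] it says that [S (g * h)] and [S h * S g] are a left and a right convolution
    inverse of the product of [H]. *)
Lemma antipode_mull g h :
  \tsum_(a, b <- comul HH g) \tsum_(x, y <- comul HH h) (S (a * x) * (b * y)) =
  (counit HH g * counit HH h)%:A.
Proof.
rewrite -(tsum_comulM (f := fun u v => S u * v)); last by lin.
by rewrite antipodel counitM.
Qed.

(** The inner factor [x * S y] collapses to the counit of [h], then [a * S b] to that of [g]. *)
Lemma antipode_mulr g h :
  \tsum_(a, b <- comul HH g) \tsum_(x, y <- comul HH h)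
    ((a * x) * (S y * S b)) = (counit HH g * counit HH h)%:A.
Proof.
rewrite mulrC -scalerA -antipoder.
rewrite (linear_tsum _ _ (linear_scaler _ (@linear_id _ _))).
apply: eq_tsum => a b; rewrite scalerAr -[S b in RHS]mul1r scalerAl -antipoder.
rewrite (linear_tsum _ _ ((mul_bilin _).1 _)) (linear_tsum _ _ ((mul_bilin _).2 _)).
by apply: eq_tsum => x y; rewrite !mulrA.
Qed.

(* Both sides are evaluations of [S(g1 h1) g2 h2 S(h3) S(g3)]. *)
Lemma antipodeM g h : S (g * h) = S h * S g.
Proof.
pose F a b c x y z := S (a * x) * (b * y) * (S z * S c).
transitivity (\tsum_(g1, g2 <- comul HH g) \tsum_(a, b <- comul HH g2)
    \tsum_(h1, h2 <- comul HH h) \tsum_(x, y <- comul HH h2) F g1 a b h1 x y).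
  (* First evaluation: insert counits on the right legs and expand their product by
     [antipode_mulr]. *)
  rewrite -[LHS](comul_counitr_linear (f := fun g => S (g * h))); last by lin.
  apply: eq_tsum => g1 g2; rewrite exchange_tsum.
  rewrite -(comul_counitr_linear (f := fun h => S (g1 * h))); last by lin.
  rewrite (linear_tsum _ _ (linear_scaler _ (@linear_id _ _))).
  apply: eq_tsum => h1 h2; rewrite scalerA -[S _ in LHS]mulr1 scalerAr.
  rewrite -antipode_mulr (linear_tsum _ _ ((mul_bilin _).2 _)).
  apply: eq_tsum => a b; rewrite (linear_tsum _ _ ((mul_bilin _).2 _)).
  by apply: eq_tsum => x y; rewrite /F !mulrA.
(* Second evaluation: regroup the legs of [g], then those of [h], to the left, so that
   [antipode_mull] collapses the first four factors. *)
rewrite -comul_assoc; last by rewrite /F; lin.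
rewrite -[S g in RHS](comul_counitl_linear (f := S)); last by lin.
rewrite (linear_tsum _ _ ((mul_bilin _).2 _)); apply: eq_tsum => g1 g2.
rewrite (eq_tsum (comul HH g1) (g := fun a b => \tsum_(h1, h2 <- comul HH h)
  \tsum_(x, y <- comul HH h1) F a b g2 x y h2)); last first.
  by move=> a b; rewrite comul_assoc // /F; lin.
rewrite exchange_tsum -[S h in RHS](comul_counitl_linear (f := S)); last by lin.
rewrite (linear_tsum _ _ ((mul_bilin _).1 _)); apply: eq_tsum => h1 h2.
rewrite -scalerAr -scalerAl scalerA -[_ * S g2 in RHS]mul1r scalerAl.
rewrite -antipode_mull (linear_tsum _ _ ((mul_bilin _).1 _)).
apply: eq_tsum => a b; rewrite (linear_tsum _ _ ((mul_bilin _).1 _)).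
by apply: eq_tsum => x y; rewrite /F !mulrA.
Qed.

Variables (Sinv : H -> H) (SK : cancel S Sinv) (SinvK : cancel Sinv S).

Lemma Sinv_linear : linear Sinv.
Proof. exact: linear_can (antipode_linear HH) SK SinvK. Qed.

(** Apply the injective map [S]: it reverses products, which turns the swapped legs into the
    antipode axiom. *)
Lemma Sinvl h :
  \tsum_(h1, h2 <- comul HH h) (Sinv h2 * h1) = (counit HH h)%:A.
Proof.
apply: (can_inj SK); rewrite (linear_tsum _ _ (antipode_linear HH)).
rewrite (linearZP _ _ (antipode_linear HH)) antipode1 -antipodel.
by apply: eq_tsum => h1 h2; rewrite antipodeM SinvK.
Qed.

Lemma Sinvr h :
  \tsum_(h1, h2 <- comul HH h) (h2 * Sinv h1) = (counit HH h)%:A.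
Proof.
apply: (can_inj SK); rewrite (linear_tsum _ _ (antipode_linear HH)).
rewrite (linearZP _ _ (antipode_linear HH)) antipode1 -antipoder.
by apply: eq_tsum => h1 h2; rewrite antipodeM SinvK.
Qed.

End Sweedler.

(** * The projection onto coinvariants *)

Section CoinvariantProjection.

Variables (k : fieldType) (H : algType k) (HH : hopf_algebra H).
Variables (Sinv : H -> H) (SK : cancel (antipode HH) Sinv).
Variables (SinvK : cancel Sinv (antipode HH)).
Variables (A : comAlgType k) (P : comodule_poisson3 HH A).
Variables (M : lmodType k) (PM : hopf_poisson3_module P M).
Variables (phi : {lrmorphism H -> A}).
Hypothesis phi_colinear : colinear (regular_comodule HH) P phi.

Local Notation p := (proj PM Sinv phi).
Let SinvL := Sinv_linear SK SinvK.
Local Ltac lin_base ::= first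
  [ exact: SinvL | apply: (linear_comp SinvL); lin ].

Lemma proj_linear : linear p.
Proof. by rewrite /proj; lin. Qed.

Lemma coact_phi (W : lmodType k) (f : A -> H -> W) h : bilin f ->
  \tsum_(a, g <- coact P (phi h)) f a g =
  \tsum_(h1, h2 <- comul HH h) f (phi h1) h2.
Proof.
move=> bf; rewrite phi_colinear (ktsum_tsum _ _ bf).
by apply: eq_tsum => h1 h2; apply: ktsum_pure.
Qed.

(** Merging the two values of [phi] and regrouping by coassociativity produces [h2 * Sinv h1], which
    [Sinvr] reduces to the counit. *)
Lemma act_phi_proj m :
  \tsum_(m0, m1 <- coact PM m) act PM (phi m1) (p m0) = m.
Proof.
rewrite -[RHS](coact_counit PM).
transitivity (\tsum_(m0, m1 <- coact PM m) \tsum_(n0, n1 <- coact PM m0)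
    act PM (phi (m1 * Sinv n1)) n0).
  apply: eq_tsum => m0 m1; rewrite (linear_tsum _ _ ((act_bilin PM).2 _)).
  by apply: eq_tsum => n0 n1; rewrite -actM rmorphM.
rewrite coact_assoc; last by lin.
apply: eq_tsum => m0 m1.
rewrite -(linear_tsum (fun h1 h2 => h2 * Sinv h1)
  (g := fun h => act PM (phi h) m0)); last by lin.
by rewrite (Sinvr SK SinvK) linearZ rmorph1 (linearZP _ _ ((act_bilin PM).1 _)) act1.
Qed.

(* [coact_act_coinv a n] is the value of the coaction on [a . n] when [n] is
   coinvariant. *)
Definition coact_act_coinv (a : A) (n : M) : ktens M H :=
  \tsum_(a0, a1 <- coact P a) (act PM a0 n \ot a1).

Lemma coact_act_coinv_bilin : bilin coact_act_coinv.
Proof. by rewrite /coact_act_coinv; lin. Qed.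

(** This is the coaction of the expansion [act_phi_proj], computed as if every [p m0] were
    coinvariant. It is derived from coassociativity and colinearity of [phi] alone, so it may serve
    to prove [proj_coinv]. *)
Lemma coact_phi_proj m : coact PM m =
  \tsum_(m0, m1 <- coact PM m) coact_act_coinv (phi m1) (p m0).
Proof.
rewrite /coact_act_coinv.
transitivity (\tsum_(m0, m1 <- coact PM m) \tsum_(h1, h2 <- comul HH m1)
    (act PM (phi h1) (p m0) \ot h2)); last first.
  by apply: eq_tsum => m0 m1; rewrite coact_phi //; lin.
have pL := proj_linear.
rewrite -(coact_assoc _ (f := fun n g h => act PM (phi g) (p n) \ot h)).
  rewrite -[LHS]tens_sumE; apply: eq_tsum => m0 m1.
  rewrite -[m0 in LHS]act_phi_proj.
  by rewrite (linear_tsum _ _ (pure_linearl _ _ _)).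
split=> ? ?; lin.
Qed.

Lemma coact_act_coinvM b a n :
  \tsum_(b0, b1 <- coact P b) \tsum_(n0, n1 <- coact_act_coinv a n)
    (act PM b0 n0 \ot (b1 * n1)) = coact_act_coinv (b * a) n.
Proof.
rewrite {2}/coact_act_coinv coact_mul ktsum_tsum; last by lin.
apply: eq_tsum => b0 b1; rewrite /coact_act_coinv !ktsum_tsum; try by lin.
by apply: eq_tsum => a0 a1; rewrite !ktsum_pure; try lin; rewrite actM.
Qed.

(** Rewriting the coaction of [m0] by [coact_phi_proj] lets [phi (Sinv m1)] and [phi n1] merge
    inside [coact_act_coinv]. Coassociativity and [Sinvl] then reduce the merged argument to a
    scalar, and [coact_act_coinv 1 (p m)] is [p m \ot 1]. *)
Lemma proj_coinv m : coinv PM (p m).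
Proof.
have [Dl Dr] := coact_act_coinv_bilin.
have pL := proj_linear.
rewrite /coinv {1}/proj (linear_tsum _ _ (coact_linear PM)).
transitivity (\tsum_(m0, m1 <- coact PM m) \tsum_(n0, n1 <- coact PM m0)
    coact_act_coinv (phi (Sinv m1 * n1)) (p n0)).
  (* Only the coaction of [m0] is expanded; that of [phi (Sinv m1)] stays whole so that
     [coact_act_coinvM] applies. *)
  apply: eq_tsum => m0 m1; rewrite coact_act [coact PM m0 in LHS]coact_phi_proj.
  have bA a0 a1 : bilin (fun n (h : H) => act PM a0 n \ot (a1 * h)) by lin.
  under eq_tsum => a0 a1 do rewrite (ktsum_tsum _ _ (bA _ _)).
  rewrite exchange_tsum; apply: eq_tsum => n0 n1.
  by rewrite coact_act_coinvM rmorphM.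
have phiD n : linear (fun h => coact_act_coinv (phi h) n).
  by apply: (linear_comp (Dl n)); lin.
have Dp a : linear (fun n => coact_act_coinv a (p n)).
  exact: linear_comp (Dr a) pL.
rewrite coact_assoc; last first.
  by split=> [? ?|? n|? n]; [exact: Dp|apply: (linear_comp (phiD _)); lin|
    apply: (linear_comp (phiD _)); lin].
transitivity (coact_act_coinv 1 (p m)); last first.
  by rewrite /coact_act_coinv coact_one ktsum_pure ?act1 //; lin.
rewrite -[p m in RHS](coact_counit_linear PM m pL).
rewrite [RHS](linear_tsum _ _ (Dr _)); apply: eq_tsum => m0 m1.
rewrite -(linear_tsum (fun h1 h2 => Sinv h2 * h1)
  (g := fun h => coact_act_coinv (phi h) (p m0))); last exact: phiD.
rewrite (Sinvl SK SinvK) linearZ rmorph1 (linearZP _ _ (Dl _)).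
by rewrite (linearZP _ _ (Dr _)).
Qed.

Lemma proj_act_coinv a m : coinv PM m ->
  p (act PM a m) = act PM (proj (regular_module P) Sinv phi a) m.
Proof.
move=> mH; rewrite /proj coact_act mH.
have bG : bilin (fun n h => act PM (phi (Sinv h)) n) by lin.
rewrite (ktsum_tsum _ _ bG) (linear_tsum _ _ ((act_bilin PM).1 m)).
apply: eq_tsum => a0 a1; rewrite ktsum_pure; last by lin.
by rewrite (ktsum_pure _ _ bG) mulr1 actM.
Qed.

Hypothesis trivial : forall x y m,
  coinv PM m -> proj_dia PM Sinv phi x y m = 0.

Lemma dia_coinv x y m : coinv PM m -> dia PM x y m = 0.
Proof.
move=> mH; rewrite -[LHS]act_phi_proj coact_dia.
have pL := proj_linear.
have bG : bilin (fun n h => act PM (phi h) (p n)).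
  by split=> [h|n]; [apply: (linear_comp ((act_bilin PM).2 _))|lin].
(* Since [m] is coinvariant, each summand is a value of [phi] acting on [p] of [dia PM x0 y0 m],
   which [trivial] kills. *)
rewrite (ktsum_tsum _ _ bG) tsum_eq0 // => x0 x1.
rewrite (ktsum_tsum _ _ bG) tsum_eq0 // => y0 y1.
rewrite mH ktsum_pure; last first.
  have [_ _ diaL] := dia_trilinear PM.
  by split=> ?; [apply: kpure_linear_l; exact: diaL|lin].
rewrite ktsum_pure // -/(proj_dia PM Sinv phi x0 y0 m) trivial //.
exact: linear0P ((act_bilin PM).2 _).
Qed.

End CoinvariantProjection.

(** * Inverses of morphisms, and [alpha] as a morphism *)

Section Isomorphism.

Variables (k : fieldType) (H : algType k) (HH : hopf_algebra H).
Variables (A : comAlgType k) (P : comodule_poisson3 HH A).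

Lemma hopf_poisson3_isomorphism_can (M N : lmodType k)
    (PM : hopf_poisson3_module P M) (PN : hopf_poisson3_module P N)
    (f : M -> N) (g : N -> M) : hopf_poisson3_morphism PM PN f ->
  cancel f g -> cancel g f -> hopf_poisson3_isomorphism PM PN f.
Proof.
move=> fP fK gK; split=> //; exists g; split=> //.
have [fL fact fdia fcol] := fP.
have gL : linear g by apply: linear_can fL fK gK.
split=> // [a n|x y n|n]; try by apply: (can_inj fK); rewrite ?fact ?fdia !gK.
(* Writing [n] as [f (g n)] brings in colinearity of [f]; then [g] cancels [f] in the left leg. *)
rewrite -[n in RHS]gK fcol ktsum_tsum; last first.
  by split=> ?; [apply: kpure_linear_l|apply: kpure_linear_r].
rewrite -[LHS]tens_sumE; apply: eq_tsum => m0 m1.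
rewrite ktsum_pure ?fK //.
by split=> ?; [apply: kpure_linear_l|apply: kpure_linear_r].
Qed.

Variables (M : lmodType k) (PM : hopf_poisson3_module P M).

Local Notation subM := (subMcoH PM).

Lemma subMcoH_coact (m : subM) : coact PM (val m) = val m \ot 1.
Proof. by case/McoH_predP: (valP m). Qed.

Lemma subMcoH_dia (m : subM) x y : dia PM x y (val m) = 0.
Proof. by case/McoH_predP: (valP m). Qed.

Lemma alpha_balanced :
  balanced (fun b : subAcoH P => mulB b) (@actB _ _ _ _ P _ PM)
    (fun a (m : subM) => act PM a (val m)).
Proof.
split=> [a b m|a m n|b a m].
- exact: linearDP (act_linearl PM _).
- by rewrite raddfD (linearDP _ _ (act_linearr PM _)).
- by rewrite /= /mulB actM.
Qed.

Lemma alphaE a (m : subM) : alpha (pureB a m) = act PM a (val m).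
Proof. exact: tsum_pure alpha_balanced. Qed.

Lemma alpha_linear : linear (@alpha _ _ _ _ P _ PM).
Proof. by apply: tsum_linear alpha_balanced _ => m; apply: act_linearl. Qed.

(** Leibniz at [1 * 1] equates [br P x y 1] with its double, so brackets with [1] vanish. Scalars
    thus lie in [B], which [pureB_linearr] uses to move them across the tensor sign. *)
Lemma AcoH_inv_scalar c : AcoH_inv P (c%:A).
Proof.
have [brL _ _] := br_trilinear P.
have br1 x y : br P 1 x y = 0.
  rewrite -br_cycle; apply: (addrI (br P x y 1)).
  by have := br_leibniz P x y 1 1; rewrite !mulr1 mul1r addr0 => <-.
split=> [x y|]; first by rewrite (linearZP _ _ (brL x y)) br1 scaler0.
rewrite /coinv (linearZP _ _ (coact_linear P)) coact_one.
by rewrite (linearZP _ _ (pure_linearl _ _ _)).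
Qed.

Lemma pureB_linearr a : linear (fun m : subM => pureB a m).
Proof.
move=> c m n; rewrite /pureB pureDr; congr (_ + _).
pose b : subAcoH P := exist _ _ (AcoH_inv_scalar c).
have -> : c *: m = actB b m.
  by apply: val_inj; rewrite linearZ /= (linearZP _ _ (act_linearl PM _)) act1.
by rewrite -[LHS]pureB_bal /= -scalerAr mulr1 (linearZP _ _ (pureB_linearl _)).
Qed.

(** On pure tensors, the Leibniz rule for [dia] loses its second term because [m] lies in [M^A], and
    the coaction of [act PM a (val m)] reduces to that of [a] because [m] is coinvariant. *)
Lemma alpha_morphism :
  hopf_poisson3_morphism (tensB_module PM) PM (@alpha _ _ _ _ P _ PM).
Proof.
have aL := alpha_linear.
split=> // [x t|x y t|t]; move: t.
- apply: tensB_ext => [||a m].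
  + exact: linear_comp aL (tensB_act_linear x).
  + exact: linear_comp (act_linearr PM x) aL.
  by rewrite /= tensB_actE !alphaE actM.
- have [_ _ diaL] := dia_trilinear PM.
  apply: tensB_ext => [||a m].
  + exact: linear_comp aL (tensB_dia_linear x y).
  + exact: linear_comp (diaL x y) aL.
  rewrite /= tensB_diaE !alphaE dia_act subMcoH_dia.
  by rewrite (linear0P (act_linearr PM a)) addr0.
have bA : bilin (fun (t : tensB PM) (h : H) => alpha t \ot h).
  by split=> ?; [apply: kpure_linear_l|apply: kpure_linear_r].
apply: tensB_ext => [||a m].
- exact: linear_comp (coact_linear PM) aL.
- exact: ktsum_comp (coact_linear (tensB_module PM)) bA.
rewrite /= tensB_coactE alphaE coact_act subMcoH_coact (ktsum_tsum _ _ bA).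
apply: eq_tsum => a0 a1; rewrite (ktsum_pure _ _ bA) alphaE ktsum_pure ?mulr1 //.
by lin.
Qed.

End Isomorphism.

Theorem theorem3p6 (k : fieldType) (char0 : [pchar k] =i pred0)
    (H : algType k) (HH : hopf_algebra H)
    (Sinv : H -> H) (SK : cancel (antipode HH) Sinv)
    (SinvK : cancel Sinv (antipode HH))
    (A : comAlgType k) (P : comodule_poisson3 HH A)
    (M : lmodType k) (PM : hopf_poisson3_module P M)
    (phi : {lrmorphism H -> A})
    (phi_center : forall h : H, lie3_center P (phi h))
    (phi_colinear : colinear (regular_comodule HH) P phi)
    (M_trivial : forall (x y : A) (m : M),
       coinv PM m -> proj_dia PM Sinv phi x y m = 0)
    (A_trivial : forall x y a : A,
       coinv P a -> proj_dia (regular_module P) Sinv phi x y a = 0) :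
  (forall (a : A) (m : subMcoH PM), alpha (pureB a m) = act PM a (val m)) /\
  hopf_poisson3_isomorphism (tensB_module PM) PM (@alpha k H HH A P M PM).
Proof.
split; first exact: alphaE.
have pM m : proj PM Sinv phi m \in McoH_pred PM.
  apply/McoH_predP; have mH := proj_coinv SK SinvK PM phi_colinear m.
  by split=> // x y; apply: (dia_coinv SK SinvK M_trivial).
have pA a : AcoH_inv P (proj (regular_module P) Sinv phi a).
  have aH := proj_coinv SK SinvK (regular_module P) phi_colinear a.
  (* The center has its element in the first slot of the bracket, the regular action in the last; a
     cyclic shift matches them. *)
  split=> // x y; rewrite -br_cycle.
  exact: (dia_coinv SK SinvK (PM := regular_module P) A_trivial x y aH).
pose q m : subMcoH PM := exist (fun n => n \in McoH_pred PM) _ (pM m).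
have qL : linear q.
  move=> c m n; apply: val_inj; rewrite linearP /=.
  exact: (proj_linear SK SinvK).
pose g m := \tsum_(m0, m1 <- coact PM m) pureB (phi m1) (q m0).
have bG : bilin (fun m h => pureB (phi h) (q m)).
  split=> [h|m]; last first.
    exact: (linear_comp (pureB_linearl _) (@linear_rmorph _ _ _ _)).
  exact: (linear_comp (pureB_linearr (phi h)) qL).
have gL : linear g by exact: ktsum_comp (coact_linear PM) bG.
apply: (hopf_poisson3_isomorphism_can (alpha_morphism PM) (g := g)) => [|m]; last first.
  (* [alpha (g m)] is the expansion of [m] in [act_phi_proj]. *)
  rewrite /g (linear_tsum _ _ (alpha_linear (PM := PM))).
  rewrite -[RHS](act_phi_proj SK SinvK PM phi).
  by apply: eq_tsum => m0 m1; rewrite alphaE.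
apply: tensB_ext => [||a m].
- exact: linear_comp gL (alpha_linear (PM := PM)).
- exact: linear_id.
rewrite alphaE /g coact_act subMcoH_coact (ktsum_tsum _ _ bG).
(* Expand [a] as the sum of [phi a1] times the projection of [a0]. That projection lies in [B], so
   it crosses the tensor sign and becomes [q] of [act PM a0 (val m)] on the right. *)
rewrite -[a in RHS](act_phi_proj SK SinvK (regular_module P) phi).
rewrite (linear_tsum _ _ (pureB_linearl m)); apply: eq_tsum => a0 a1.
rewrite ktsum_pure; last by lin.
rewrite (ktsum_pure _ _ bG) mulr1.
pose b : subAcoH P := exist _ _ (pA a0).
have -> : q (act PM a0 (val m)) = actB b m.
  by apply: val_inj; apply: (proj_act_coinv SK SinvK); apply: subMcoH_coact.
by rewrite -pureB_bal.
Qed.
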